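(* For every $\beta>0$, there exist non-decreasing functions $R\in C^1(\mathbb{R}_+;(0,+\infty))$ and $\kappa\in C^0(\mathbb{R}_+;(0,+\infty))$ such that the following inequalities hold for all $(s,v)\in\Omega$: $$H(s,v)\le W(s,v)\le \kappa(H(s,v))\,H(s,v),$$ $$\dot W(s,v)\le -\beta\mu\sum_{i=1}^n (v_i-v^* )^2-\frac18\sum_{i=2}^n 4^i\,(V'(s_i))^2,$$ where $W:\Omega\to\mathbb{R}_+$ is defined by $$W(s,v):=R(H(s,v))\,H(s,v)-\sum_{i=2}^n 4^i\,V'(s_i)(v_i-v^* )\quad\text{for all }(s,v)\in\Omega,$$ and $\dot W(s,v)$ denotes the time derivative of $W$ along the solutions of the microscopic inviscid ACC model.
   Context: Notation: $\mathbb{R}_+=[0,+\infty)$. Let $n\ge 2$ be an integer and let $\mu>0$, $\lambda>L>0$, $v_{\max}>v^*>0$ be constants. Let $V\in C^2((L,+\infty);\mathbb{R}_+)$ satisfy: $\lim_{s\to L^+}V(s)=+\infty$; $V''(s)\ge 0$ for all $s>L$; $V(s)=0$ for all $s\ge\lambda$; $V'(s)<0$ for all $s\in(L,\lambda)$. Let $f\in C^1(\mathbb{R})$ be non-decreasing with $\max(x,0)\le f(x)$ for all $x\in\mathbb{R}$, and define $$g(x)=\frac{v_{\max}f(x)}{v^*(v_{\max}-v^* )}-\frac{x}{v^*},\quad x\in\mathbb{R}.$$ Define $k_1(s_2)=\mu+g(-V'(s_2))$, $k_i(s_i,s_{i+1})=\mu+g(V'(s_i)-V'(s_{i+1}))$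 for $i=2,\dots,n-1$, and $k_n(s_n)=\mu+g(V'(s_n))$. The microscopic inviscid ACC model, with state $(s,v)$, $s=(s_2,\dots,s_n)\in\mathbb{R}^{n-1}$, $v=(v_1,\dots,v_n)\in\mathbb{R}^n$, is the ODE system $$\dot s_i=v_{i-1}-v_i,\quad i=2,\dots,n,$$ $$\dot v_1=-k_1(s_2)(v_1-v^* )-V'(s_2),$$ $$\dot v_i=-k_i(s_i,s_{i+1})(v_i-v^* )+V'(s_i)-V'(s_{i+1}),\quad i=2,\dots,n-1,$$ $$\dot v_n=-k_n(s_n)(v_n-v^* )+V'(s_n),$$ with state space $$\Omega=\Big\{(s_2,\dots,s_n,v_1,\dots,v_n)\in\mathbb{R}^{2n-1}:\ \min_{i=2,\dots,n}s_i>L,\ \max_{i=1,\dots,n}v_i\le v_{\max},\ \min_{i=1,\dots,n}v_i\ge 0\Big\}.$$ The function $H:\Omega\to\mathbb{R}_+$ is $$H(s,v)=\frac12\sum_{i=1}^n(v_i-v^* )^2+\sum_{i=2}^n V(s_i).$$ The time derivative of $W$ along solutions is $\dot W(s,v)=\sum_{i=2}^n\frac{\partial W}{\partial s_i}(s,v)\,(v_{i-1}-v_i)+\sum_{i=1}^n\frac{\partial W}{\partial v_i}(s,v)\,F_i(s,v)$, where $F_i(s,v)$ is the right-hand side of the $\dot v_i$ equation above (partial derivatives are computed from the formula for $W$, which makes sense on the open set where all $s_i>L$). *)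

(* Defs.v *)
From HB Require Import structures.
From mathcomp Require Import all_boot all_order all_algebra.
From mathcomp Require Import all_classical all_reals all_analysis.
Import Order.TTheory GRing.Theory Num.Theory.
Import numFieldNormedType.Exports.
Set Implicit Arguments.
Unset Strict Implicit.
Unset Printing Implicit Defensive.
Local Open Scope ring_scope.
Local Open Scope classical_set_scope.

(* C^k on the open half-line ]a, +oo[, for k = 2, and on the closed half-line
   R_+, for k = 1.  In the second case the function is given as a function on
   all of R of which only the values on R_+ matter; its derivative on
   ]0, +oo[ is required to extend continuously to 0 (equivalently, there is a
   one-sided derivative at 0 and the derivative is continuous on R_+). *)
Definition C2_right_of (R : realType) (a : R) (h : R -> R) : Prop :=
  forall x : R, a < x ->
    [/\ derivable h x 1, derivable (derive1 h) x 1
      & {for x, continuous (derive1n 2 h)}].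

Definition C1_real (R : realType) (h : R -> R) : Prop :=
  (forall x : R, derivable h x 1) /\ continuous (derive1 h).

Definition C0_nonneg (R : realType) (h : R -> R) : Prop :=
  {within `[0, +oo[%classic, continuous h}.

Definition C1_nonneg (R : realType) (h : R -> R) : Prop :=
  C0_nonneg h /\
  exists2 d : R -> R, C0_nonneg d &
    forall x : R, 0 < x -> is_derive x 1 h (d x).

Definition nondecreasing_nonneg (R : realType) (h : R -> R) : Prop :=
  forall x y : R, 0 <= x -> x <= y -> h x <= h y.

Definition positive_nonneg (R : realType) (h : R -> R) : Prop :=
  forall x : R, 0 <= x -> 0 < h x.

(* u_k for k < m, with the value 0 out of range (never used below). *)
Definition coord (R : realType) (m : nat) (u : 'rV[R]_m) (k : nat) : R :=
  oapp (u ord0) 0 (insub k : option 'I_m).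

(* s = (s_2, ..., s_n) and v = (v_1, ..., v_n): [gap s i] is s_i for
   2 <= i <= n and [speed v i] is v_i for 1 <= i <= n. *)
Definition gap (R : realType) (n : nat) (s : 'rV[R]_n.-1) (i : nat) : R :=
  coord s (i - 2).

Definition speed (R : realType) (n : nat) (v : 'rV[R]_n) (i : nat) : R :=
  coord v (i - 1).

(* Partial derivatives with respect to s_i (2 <= i <= n), v_i (1 <= i <= n). *)
Definition partial_gap (R : realType) (n : nat)
    (W : 'rV[R]_n.-1 -> 'rV[R]_n -> R) (i : nat)
    (s : 'rV[R]_n.-1) (v : 'rV[R]_n) : R :=
  'D_(\row_(j < n.-1) (j.+2 == i)%:R) (fun s' => W s' v) s.

Definition partial_speed (R : realType) (n : nat)
    (W : 'rV[R]_n.-1 -> 'rV[R]_n -> R) (i : nat)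
    (s : 'rV[R]_n.-1) (v : 'rV[R]_n) : R :=
  'D_(\row_(j < n) (j.+1 == i)%:R) (fun v' => W s v') v.

Definition Omega (R : realType) (n : nat) (L vmax : R)
    (s : 'rV[R]_n.-1) (v : 'rV[R]_n) : Prop :=
  (forall i, (2 <= i <= n)%N -> L < gap s i) /\
  (forall i, (1 <= i <= n)%N -> 0 <= speed v i <= vmax).

Definition gfun (R : realType) (vmax vstar : R) (f : R -> R) (x : R) : R :=
  vmax * f x / (vstar * (vmax - vstar)) - x / vstar.

Definition kgain (R : realType) (n : nat) (mu vmax vstar : R) (V f : R -> R)
    (i : nat) (s : 'rV[R]_n.-1) : R :=
  let g := gfun vmax vstar f in
  if i == 1%N then mu + g (- derive1 V (gap s 2))
  else if i == n then mu + g (derive1 V (gap s n))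
  else mu + g (derive1 V (gap s i) - derive1 V (gap s i.+1)).

Definition accel (R : realType) (n : nat) (mu vmax vstar : R) (V f : R -> R)
    (i : nat) (s : 'rV[R]_n.-1) (v : 'rV[R]_n) : R :=
  let k := kgain mu vmax vstar V f i s in
  if i == 1%N then - k * (speed v 1 - vstar) - derive1 V (gap s 2)
  else if i == n then - k * (speed v n - vstar) + derive1 V (gap s n)
  else - k * (speed v i - vstar) + derive1 V (gap s i) - derive1 V (gap s i.+1).

Definition time_derivative (R : realType) (n : nat) (mu vmax vstar : R)
    (V f : R -> R) (W : 'rV[R]_n.-1 -> 'rV[R]_n -> R)
    (s : 'rV[R]_n.-1) (v : 'rV[R]_n) : R :=
  \sum_(2 <= i < n.+1)
     partial_gap W i s v * (speed v (i - 1) - speed v i) +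
  \sum_(1 <= i < n.+1)
     partial_speed W i s v * accel mu vmax vstar V f i s v.

Definition Hfun (R : realType) (n : nat) (vstar : R) (V : R -> R)
    (s : 'rV[R]_n.-1) (v : 'rV[R]_n) : R :=
  2^-1 * (\sum_(1 <= i < n.+1) (speed v i - vstar) ^+ 2) +
  \sum_(2 <= i < n.+1) V (gap s i).

Definition Wfun (R : realType) (n : nat) (vstar : R) (V r : R -> R)
    (s : 'rV[R]_n.-1) (v : 'rV[R]_n) : R :=
  r (Hfun vstar V s v) * Hfun vstar V s v -
  \sum_(2 <= i < n.+1) 4 ^+ i * derive1 V (gap s i) * (speed v i - vstar).

(* Main.v *)
Require Import Defs.
From HB Require Import structures.
From mathcomp Require Import all_boot all_order all_algebra.
From mathcomp Require Import all_classical all_reals all_analysis.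
From mathcomp Require Import ring lra.
Import Order.TTheory GRing.Theory Num.Theory.
Import numFieldNormedType.Exports.
Local Open Scope ring_scope.
Local Open Scope classical_set_scope.

(** Write w_i = v_i - v*, P_i = V'(s_i), q_i = V''(s_i), with P_1 = P_{n+1} = 0.
    Then H' = - sum k_i w_i^2, and the cross term of W contributes
    - sum 4^i P_i^2 up to products that Young's inequality absorbs; the weights
    4^i make the terms 4^i P_i P_{i+1} absorbable. What remains is at most
    C (sum w_i^2), where C depends only on bounds K and Q for k_i and q_i. On
    {H <= h} the blow-up of V at L keeps the gaps away from L, so K and Q exist
    there, as does the bound V'^2 <= 2 Q V, which makes the cross term O(H).
    Hence it suffices that R dominate a locally bounded function of H. As a
    C^1 nondecreasing majorant we use C + sum_k c_k max(0, h - k)^2, and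
    kappa = 2 R. *)

Set Implicit Arguments.
Unset Strict Implicit.
Unset Printing Implicit Defensive.

(** * Algebraic core of the decay estimate *)

(* a stands for 4^i; w0, P1, q1 are w_{i-1}, P_{i+1}, q_{i+1}. The last summand
   on the right is G_i - G_{i+1} and telescopes over i. *)
Lemma lyapunov_term (R : realType) (a A k M mu bmu w0 w P P1 q q1 : R) :
  0 < mu -> mu <= k -> 0 <= a -> 0 <= A ->
  0 <= q -> a * q <= M -> 4 * a * q1 <= M ->
  bmu + a * k ^+ 2 + 2 * M <= A * k ->
  (A * P - a * q * w) * (w0 - w) + (A * w - a * P) * (- k * w + P - P1)
  <= - (bmu * w ^+ 2) - 8^-1 * (a * P ^+ 2)
     + ((A * P * w0 - a / 8 * P ^+ 2 + a / 2 * q * w0 ^+ 2)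
        - (A * P1 * w - (4 * a) / 8 * P1 ^+ 2 + (4 * a) / 2 * q1 * w ^+ 2)).
Proof.
move=> mu0 muk a0 A0 q0 hq hq1 hA.
(* The losses a P^2/4 here and a P^2/2 in [y2] leave -a P^2/4: one half is the announced decay, the
   other telescopes, because a P1^2/2 = (4a)/8 P1^2. This is what fixes the ratio 4 of the weights.
   In 2 M, the part 3/2 M pays for the two q-terms of index i and 1/2 M for the telescoped one of
   index i + 1. *)
have y1 : a * (k * P * w) <= a * (k ^+ 2 * w ^+ 2 + P ^+ 2 / 4).
  by apply: ler_wpM2l => //; have := sqr_ge0 (k * w - P / 2); lra.
have y2 : a * (P * P1) <= a * (P ^+ 2 / 2 + P1 ^+ 2 / 2).
  by apply: ler_wpM2l => //; have := sqr_ge0 (P - P1); lra.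
have y3 : a * q * (- (w * w0)) <= a * q * (w ^+ 2 / 2 + w0 ^+ 2 / 2).
  by apply: ler_wpM2l; [exact: mulr_ge0|have := sqr_ge0 (w + w0); lra].
have y4 := ler_wpM2r (sqr_ge0 w) hA.
have y5 := ler_wpM2r (sqr_ge0 w) hq.
have y6 := ler_wpM2r (sqr_ge0 w) hq1.
lra.
Qed.

Lemma telescoping_sum_le (R : numDomainType) (m n : nat) (F B G : nat -> R) :
  (m <= n)%N -> G m = 0 -> G n = 0 ->
  (forall i, (m <= i < n)%N -> F i <= B i + (G i - G i.+1)) ->
  \sum_(m <= i < n) F i <= \sum_(m <= i < n) B i.
Proof.
move=> mn Gm Gn hF; apply: (@le_trans _ _ (\sum_(m <= i < n) (B i + (G i - G i.+1)))).
  rewrite big_seq_cond [leRHS]big_seq_cond; apply: ler_sum => i.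
  by rewrite mem_index_iota andbT; exact: hF.
rewrite big_split /= -[leRHS]addr0 lerD2l.
under eq_bigr do rewrite -opprB.
by rewrite sumrN telescope_sumr// Gm Gn subrr oppr0.
Qed.

(** * Derivatives along lines and of finite sums *)

(** Turns a partial derivative into the derivative at 0 of a real function, to which the scalar
    product and chain rules apply. *)
Lemma derive_along_line (R : realType) (V : normedModType R) (f : V -> R) (a v : V) (d : R) :
  is_derive (0 : R) 1 (fun t : R => f (t *: v + a)) d -> 'D_v f a = d.
Proof.
move=> [_ <-]; rewrite /derive /= scale0r add0r.
have FG : (fun h : R => h^-1 *: (f (h *: v + a) - f a))
  = (fun h : R => h^-1 *: (f ((h *: (1 : R) + 0 : R) *: v + a) - f a)).
  by apply/funext => h; rewrite addr0 [h *: 1]mulr1.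
by rewrite FG.
Qed.

Lemma is_derive_bigsum (R : realType) (I : eqType) (r : seq I)
    (F : I -> R -> R) (dF : I -> R) (x : R) :
  (forall i, i \in r -> is_derive x 1 (F i) (dF i)) ->
  is_derive x 1 (fun t => \sum_(i <- r) F i t) (\sum_(i <- r) dF i).
Proof.
elim: r => [|i r IH] hF.
  rewrite big_nil; under eq_fun do rewrite big_nil; exact: (is_derive_cst (0:R)  x 1).
rewrite big_cons; under eq_fun do rewrite big_cons.
apply: is_deriveD; first by apply: hF; rewrite mem_head.
by apply: IH => j jr; apply: hF; rewrite inE jr orbT.
Qed.

(** * A C^1 nondecreasing majorant of a sequence *)

Lemma continuous_pos_part (R : realType) (k : R) :
  continuous (fun t : R => Num.max 0 (t - k)).
Proof.
move=> x; apply: (@continuous_max R R (cst 0) (fun t => t - k)).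
  exact: cvg_cst.
by apply: cvgB; [exact: cvg_id|exact: cvg_cst].
Qed.

(** Squaring removes the kink: at t = k the difference quotient with increment h is max(0, h), which
    tends to 0. *)
Lemma is_derive_sqr_pos_part (R : realType) (k x : R) :
  is_derive x 1 (fun t => Num.max 0 (t - k) ^+ 2) (2 * Num.max 0 (x - k)).
Proof.
have [xk|kx|->] := ltgtP x k.
- have -> : 2 * Num.max 0 (x - k) = 0 by rewrite max_l ?mulr0// subr_le0 ltW.
  apply: near_eq_is_derive (is_derive_cst (0 : R) x 1).
  near=> y; rewrite max_l ?expr0n//= subr_le0 ltW//.
  by near: y; exact: lt_nbhsl.
- rewrite max_r ?subr_ge0 ?ltW//.
  apply: (@near_eq_is_derive _ _ _ (fun t => (t - k) ^+ 2)).
    near=> y; rewrite max_r// subr_ge0 ltW//.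
    by near: y; exact: lt_nbhsr.
  have -> : (fun t => (t - k) ^+ 2) = (@id R - cst k) ^+ 2 by [].
  apply: is_derive_eq.
  by rewrite subr0 /= expr1 [_ *: _]mulr1.
- rewrite subrr maxxx mulr0.
  suff H : h^-1 *: (((fun t => Num.max 0 (t - k) ^+ 2) \o shift k) (h *: 1)
       - Num.max 0 (k - k) ^+ 2) @[h --> 0^'] --> (0 : R).
    by apply: DeriveDef; [apply/cvg_ex; exists 0; exact: H|exact: cvg_lim H].
  have H0 : Num.max 0 h @[h --> (0 : R)^'] --> (0 : R).
    apply: cvg_within_filter.
    have := @continuous_pos_part R 0 0.
    by rewrite /continuous_at subr0 maxxx; under eq_fun do rewrite subr0.
  apply: cvg_trans H0; apply: near_eq_cvg; near=> h.
  rewrite /= subrr maxxx expr0n subr0 addrK [h *: 1]mulr1 /GRing.scale /=.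
  have h0 : h != 0 by near: h; exact: nbhs_dnbhs_neq.
  have [hn|hp] := leP h 0.
    by rewrite expr0n mulr0.
  by rewrite expr2 mulKf.
Unshelve. all: by end_near. Qed.

(** The infinite series of the phi_k, meant for phi_k that vanish on ]-oo, k]: at x only the indices
    up to [truncn x] can contribute. *)
Definition locally_finite_sum (R : realType) (phi : nat -> R -> R) (x : R) : R :=
  \sum_(0 <= k < (Num.truncn x).+1) phi k x.

Lemma locally_finite_sumE (R : realType) (phi : nat -> R -> R) (N : nat) (x : R) :
  (forall k y, y <= k%:R -> phi k y = 0) -> (Num.truncn x < N)%N ->
  locally_finite_sum phi x = \sum_(0 <= k < N) phi k x.
Proof.
move=> phi0 xN; rewrite [RHS](@big_cat_nat _ _ _ (Num.truncn x).+1)//=.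
rewrite [X in _ + X]big_nat_cond [X in _ + X]big1 ?addr0// => k.
rewrite andbT => /andP[xk _]; apply: phi0.
by rewrite (le_trans (ltW (truncnS_gt x)))// ler_nat.
Qed.

(** Points y near x satisfy y < [truncn x] + 1, so a fixed number of terms serves a whole
    neighbourhood; differentiability and continuity become statements on finite sums. *)
Lemma near_locally_finite_sum (R : realType) (phi : nat -> R -> R) (x : R) :
  (forall k y, y <= k%:R -> phi k y = 0) ->
  \forall y \near x,
    \sum_(0 <= k < (Num.truncn x).+1) phi k y = locally_finite_sum phi y.
Proof.
move=> phi0; near=> y; apply/esym/locally_finite_sumE => //.
by rewrite ltnS truncn_le_nat; near: y; apply: lt_nbhsl; exact: truncnS_gt.
Unshelve. all: by end_near. Qed.

Lemma exists_C1_majorant (R : realType) (Phi : nat -> R) :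
  exists r d : R -> R, [/\ forall x : R, is_derive x 1 r (d x), continuous d,
    {homo r : x y / x <= y}, forall x, 0 <= d x &
    forall x, 0 <= x -> Phi (Num.truncn x) <= r x].
Proof.
(* The index is shifted because the k-th square reaches 1 only at k + 1: if [truncn x] = k + 1, then
   x - k >= 1 and the k-th term alone is at least |Phi (k + 1)|. The constant |Phi 0| covers [0,
   1[. *)
pose c k := `|Phi k.+1|.
pose phi k (t : R) := c k * Num.max 0 (t - k%:R) ^+ 2.
pose psi k (t : R) := c k * (2 * Num.max 0 (t - k%:R)).
have max0 (t : R) k : t <= k%:R -> Num.max 0 (t - k%:R) = 0.
  by move=> tk; rewrite max_l// subr_le0.
have phi0 k t : t <= k%:R -> phi k t = 0.
  by move=> /max0 tk; rewrite /phi tk expr0n mulr0.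
have psi0 k t : t <= k%:R -> psi k t = 0.
  by move=> /max0 tk; rewrite /psi tk !mulr0.
have c0 k : 0 <= c k by exact: normr_ge0.
have max_ge0 (t : R) k : 0 <= Num.max 0 (t - k%:R) by rewrite le_max lexx.
exists (fun x => locally_finite_sum phi x + `|Phi 0%N|), (locally_finite_sum psi).
split.
- move=> x; rewrite -[locally_finite_sum psi x]addr0.
  apply: (@is_deriveD _ _ _ (locally_finite_sum phi) (cst `|Phi 0%N|)).
  apply: near_eq_is_derive; first exact: near_locally_finite_sum.
  apply: is_derive_bigsum => k _.
  exact: (@is_deriveZ _ _ _ _ (c k) _ _ _ (is_derive_sqr_pos_part k%:R x)).
- move=> x; rewrite /continuous_at (@locally_finite_sumE _ psi (Num.truncn x).+1)//.
  apply: (cvg_trans (near_eq_cvg (near_locally_finite_sum x psi0))).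
  apply: cvg_big => [|k _]; first exact: add_continuous.
  by apply: cvgM; [exact: cvg_cst|apply: cvgM; [exact: cvg_cst|exact: continuous_pos_part]].
- move=> x y xy; rewrite lerD2r.
  (* Both values are written with the number of terms that y needs, so they compare term by term. *)
  rewrite (@locally_finite_sumE _ phi (Num.truncn y).+1 x)// ?ltnS ?le_truncn//.
  apply: ler_sum => k _; apply: ler_wpM2l => //.
  rewrite lerXn2r ?nnegrE// ge_max max_ge0/= le_max lerB ?orbT//.
- by move=> x; apply: sumr_ge0 => k _; rewrite !mulr_ge0.
- move=> x x0; have [tx|tx] := posnP (Num.truncn x).
    rewrite tx (le_trans (ler_norm _))// lerDr.
    by apply: sumr_ge0 => k _; rewrite mulr_ge0// exprn_ge0.
  have [m mE] : exists m, Num.truncn x = m.+1 by exists (Num.truncn x).-1; rewrite prednK.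
  have := truncn_itv x0; rewrite mE => /andP[mx _].
  rewrite (le_trans (ler_norm _))// -[leLHS]addr0 lerD//.
  rewrite /locally_finite_sum mE big_nat_recr//= big_nat_recr//= [X in X + _]addrC -addrA.
  rewrite -[leLHS]addr0 lerD//; last first.
    apply: addr_ge0; last by rewrite mulr_ge0// exprn_ge0.
    by apply: sumr_ge0 => k _; rewrite mulr_ge0// exprn_ge0.
  rewrite -[leLHS]mulr1 ler_wpM2l// exprn_ege1// le_max orbC.
  by move: mx; rewrite -natr1 lerBrDl addrC => ->.
Qed.

(** * The potential V: monotonicity and bounds on sublevel sets *)

Lemma ger0_derive1_segment (R : realType) (h : R -> R) (x y : R) :
  x <= y -> (forall z, x <= z <= y -> derivable h z 1) ->
  (forall z, x <= z <= y -> 0 <= derive1 h z) -> h x <= h y.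
Proof.
move=> xy dh h0; apply: (@ger0_derive1_le_cc R h x y).
- by move=> z; rewrite in_itv/= => /andP[xz zy]; apply: dh; rewrite !ltW.
- by move=> z; rewrite in_itv/= => /andP[xz zy]; apply: h0; rewrite !ltW.
- by apply: derivable_within_continuous => z; rewrite in_itv; exact: dh.
- by rewrite in_itv/= lexx.
- by rewrite in_itv/= lexx andbT.
- by [].
Qed.

Lemma derive1_eventually_cst (R : realType) (h : R -> R) (a x c : R) :
  (forall y, a <= y -> h y = c) -> a < x -> derive1 h x = 0.
Proof.
move=> hc ax; rewrite derive1E -(derive_cst c x 1); apply: near_eq_derive.
by near=> y; rewrite hc// ltW//; near: y; exact: lt_nbhsr.
Unshelve. all: by end_near. Qed.

Lemma C2_derivable (R : realType) (a x : R) (h : R -> R) :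
  C2_right_of a h -> a < x -> derivable h x 1.
Proof. by move=> hC2 ax; case: (hC2 x ax). Qed.

Lemma C2_derivable_derive1 (R : realType) (a x : R) (h : R -> R) :
  C2_right_of a h -> a < x -> derivable (derive1 h) x 1.
Proof. by move=> hC2 ax; case: (hC2 x ax) => _ h2 _; exact: h2. Qed.

Lemma potential_derive1_ndecr (R : realType) (L : R) (V : R -> R) (x y : R) :
  C2_right_of L V -> (forall s : R, L < s -> 0 <= derive1n 2 V s) ->
  L < x -> x <= y -> derive1 V x <= derive1 V y.
Proof.
move=> VC2 Vconvex Lx xy; apply: ger0_derive1_segment => // z /andP[xz _].
  exact: C2_derivable_derive1 VC2 (lt_le_trans Lx xz).
exact: Vconvex (lt_le_trans Lx xz).
Qed.

(** V' is nondecreasing by convexity and vanishes to the right of [lam]. The point lam + 1 lies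
    strictly beyond [lam], so V is constant on a neighbourhood of it. *)
Lemma potential_derive1_le0 (R : realType) (L lam : R) (V : R -> R) (x : R) :
  C2_right_of L V -> (forall s : R, L < s -> 0 <= derive1n 2 V s) ->
  (forall s : R, lam <= s -> V s = 0) ->
  L < x -> derive1 V x <= 0.
Proof.
move=> VC2 Vconvex Vzero Lx; set y := Num.max x (lam + 1).
have <- : derive1 V y = 0.
  by apply: (derive1_eventually_cst Vzero); rewrite lt_max ltrDl ltr01 orbT.
by apply: (potential_derive1_ndecr VC2 Vconvex Lx); rewrite le_max lexx.
Qed.

Lemma potential_nincr (R : realType) (L lam : R) (V : R -> R) (x y : R) :
  C2_right_of L V -> (forall s : R, L < s -> 0 <= derive1n 2 V s) ->
  (forall s : R, lam <= s -> V s = 0) ->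
  L < x -> x <= y -> V y <= V x.
Proof.
move=> VC2 Vconvex Vzero Lx xy; rewrite -lerN2.
have LE z : x <= z <= y -> L < z by move=> /andP[xz _]; exact: lt_le_trans xz.
apply: (@ger0_derive1_segment _ (- V)) => // z /LE Lz.
  exact/derivableN/(C2_derivable VC2).
rewrite derive1N; last exact: (C2_derivable VC2).
by rewrite oppr_ge0 (potential_derive1_le0 VC2 Vconvex Vzero).
Qed.

(* V'^2 - 2 Q V is nondecreasing where V'' <= Q, and vanishes far away. *)
Lemma sqr_derive1_le_potential (R : realType) (L lam Q : R) (V : R -> R) (x : R) :
  C2_right_of L V -> (forall s : R, L < s -> 0 <= derive1n 2 V s) ->
  (forall s : R, lam <= s -> V s = 0) ->
  L < x -> (forall y, x <= y -> derive1n 2 V y <= Q) ->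
  derive1 V x ^+ 2 <= 2 * Q * V x.
Proof.
move=> VC2 Vconvex Vzero Lx VQ; set y := Num.max x (lam + 1).
have lamy : lam < y by rewrite lt_max ltrDl ltr01 orbT.
pose h t := derive1 V t ^+ 2 - 2 * Q * V t.
have hy : h y = 0.
  by rewrite /h (derive1_eventually_cst Vzero)// Vzero ?(ltW lamy)// expr0n mulr0 subrr.
rewrite -subr_le0 -/(h x) -hy.
have dh z : x <= z -> is_derive z 1 h (2 * (- derive1 V z) * (Q - derive1n 2 V z)).
  move=> xz; have Lz := lt_le_trans Lx xz.
  have dV1 : is_derive z 1 V (derive1 V z).
    by rewrite derive1E; exact/derivableP/(C2_derivable VC2).
  have dV2 : is_derive z 1 (derive1 V) (derive1n 2 V z).
    by rewrite derive1nS derive1n1 derive1E; exact/derivableP/(C2_derivable_derive1 VC2).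
  have -> : h = (derive1 V) ^+ 2 - (2 * Q) \*: V by [].
  apply: is_derive_eq; rewrite expr1 /GRing.scale /=; ring.
apply: ger0_derive1_segment => [|z /andP[/dh[]]//|z /andP[xz _]].
  by rewrite le_max lexx.
have dhz := dh z xz; rewrite derive1E derive_val.
rewrite mulr_ge0 ?subr_ge0 ?VQ// mulr_ge0// oppr_ge0.
exact: (potential_derive1_le0 VC2 Vconvex Vzero (lt_le_trans Lx xz)).
Qed.

(** The sublevel set lies in [a, +oo[ for some a > L. There V'' is bounded, by compactness up to lam
    + 1 and because it is 0 afterwards, and V' is at least V'(a) by monotonicity. *)
Lemma potential_sublevel_bounds (R : realType) (L lam : R) (V : R -> R) (h : R) :
  C2_right_of L V -> L < lam -> V s @[s --> L^'+] --> +oo ->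
  (forall s : R, L < s -> 0 <= derive1n 2 V s) ->
  (forall s : R, lam <= s -> V s = 0) ->
  exists Q B : R, [/\ 0 <= Q, 0 <= B & forall x, L < x -> V x <= h ->
    [/\ derive1n 2 V x <= Q, - B <= derive1 V x
      & derive1 V x ^+ 2 <= 2 * Q * V x]].
Proof.
move=> VC2 Llam Vlim Vconvex Vzero.
(* The blow-up at L gives V a > h for a close to L, and V is nonincreasing, so V > h on ]L, a[. The
   bound a < lam + 1 makes the segment used below nonempty. *)
have [a [La alam Va]] : exists a, [/\ L < a, a < lam + 1 &
    forall x, L < x -> V x <= h -> a <= x].
  have /cvgryPgt/(_ h) Vh := Vlim.
  near L^'+ => a; exists a; split.
  - by near: a; exact: nbhs_right_gt.
  - by near: a; apply: nbhs_right_lt; rewrite (lt_trans Llam)// ltrDl.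
  - move=> x Lx; apply: contraTT; rewrite -!ltNge => xa.
    have hVa : h < V a by near: a.
    by apply: (lt_le_trans hVa); apply: (potential_nincr VC2 Vconvex Vzero); rewrite // ltW.
have [c cin cmax] : exists2 c, c \in `[a, lam + 1]%R &
    forall t, t \in `[a, lam + 1]%R -> derive1n 2 V t <= derive1n 2 V c.
  apply: EVT_max; first exact: ltW.
  apply: continuous_in_subspaceT => z; rewrite inE/= in_itv/= => /andP[az _].
  by case: (VC2 z (lt_le_trans La az)) => _ _; exact.
have Lc : L < c by move: cin; rewrite in_itv/= => /andP[ac _]; exact: lt_le_trans ac.
have VQ x : a <= x -> derive1n 2 V x <= derive1n 2 V c.
  move=> ax; have [xl|lx] := leP x (lam + 1); first by apply: cmax; rewrite in_itv/= ax.
  rewrite derive1nS derive1n1 (@derive1_eventually_cst _ _ (lam + 1) _ 0)//.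
    exact: Vconvex.
  move=> y ly; apply: (derive1_eventually_cst Vzero).
  by rewrite (lt_le_trans _ ly)// ltrDl.
exists (derive1n 2 V c), (- derive1 V a); split; first exact: Vconvex.
  by rewrite oppr_ge0; exact: (potential_derive1_le0 VC2 Vconvex Vzero).
move=> x Lx /(Va _ Lx) ax; split.
- exact: VQ.
- by rewrite opprK; exact: (potential_derive1_ndecr VC2 Vconvex La ax).
- apply: (sqr_derive1_le_potential VC2 Vconvex Vzero Lx) => y xy.
  by apply: VQ; exact: le_trans xy.
Unshelve. all: by end_near. Qed.

(** * Bounds on the gains *)

Lemma gfun_ge0 (R : realType) (vmax vstar : R) (f : R -> R) (x : R) :
  0 < vstar -> vstar < vmax -> (forall x : R, Num.max x 0 <= f x) ->
  0 <= gfun vmax vstar f x.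
Proof.
move=> vs0 vsm fge; rewrite /gfun.
have d0 : 0 < vmax - vstar by rewrite subr_gt0.
have -> : vmax * f x / (vstar * (vmax - vstar)) - x / vstar =
   (vmax * f x - x * (vmax - vstar)) / (vstar * (vmax - vstar)).
  by field; rewrite !gt_eqF.
rewrite divr_ge0 ?mulr_ge0 ?(ltW vs0) ?(ltW d0)//.
have := fge x; rewrite ge_max => /andP[xf f0].
have := mulr_ge0 (ltW vs0) f0.
have := mulr_ge0 (ltW d0) f0.
have [x0|x0] := leP 0 x; first nra.
nra.
Qed.

(** Only the part of g in f is known to be monotone. The correction 2 B / v* turns the -B / v*
    inside g(B) into B / v*, the largest value of -x / v* on [-B, B]. *)
Lemma gfun_le (R : realType) (vmax vstar B : R) (f : R -> R) (x : R) :
  0 < vstar -> vstar < vmax -> (forall x y : R, x <= y -> f x <= f y) ->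
  - B <= x <= B ->
  gfun vmax vstar f x <= gfun vmax vstar f B + 2 * B / vstar.
Proof.
move=> vs0 vsm fmono /andP[Bx xB]; rewrite /gfun.
have d0 : 0 < vmax - vstar by rewrite subr_gt0.
have y1 : vmax * f x / (vstar * (vmax - vstar)) <= vmax * f B / (vstar * (vmax - vstar)).
  rewrite ler_pM2r ?invr_gt0 ?mulr_gt0// ler_pM2l ?fmono//.
  exact: lt_trans vsm.
have y2 : - (x / vstar) <= B / vstar.
  by rewrite -mulNr ler_pM2r ?invr_gt0// lerNl.
lra.
Qed.

(** * Coordinates, and the partial derivatives of H and W *)

Lemma coord_ord (R : realType) (m k : nat) (u : 'rV[R]_m) (km : (k < m)%N) :
  Defs.coord u k = u ord0 (Ordinal km).
Proof. by rewrite /Defs.coord insubT. Qed.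

Lemma coord_out (R : realType) (m k : nat) (u : 'rV[R]_m) :
  (m <= k)%N -> Defs.coord u k = 0.
Proof. by move=> mk; rewrite /Defs.coord insubF// ltnNge mk. Qed.

Lemma coordZD (R : realType) (m k : nat) (t : R) (e u : 'rV[R]_m) :
  Defs.coord (t *: e + u) k = t * Defs.coord e k + Defs.coord u k.
Proof.
have [km|mk] := ltnP k m; first by rewrite !coord_ord !mxE.
by rewrite !coord_out// mulr0 addr0.
Qed.

Lemma coord0 (R : realType) (m k : nat) : Defs.coord (0 : 'rV[R]_m) k = 0.
Proof.
by have [km|mk] := ltnP k m; [rewrite coord_ord mxE|rewrite coord_out].
Qed.

Lemma is_derive_coord (R : realType) (m k : nat) (e u : 'rV[R]_m) :
  is_derive (0 : R) 1 (fun t => Defs.coord (t *: e + u) k) (Defs.coord e k).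
Proof.
under eq_fun do rewrite coordZD mulrC.
apply: (@is_derive_eq _ _ _ ((Defs.coord e k) \*: id + cst (Defs.coord u k))).
by rewrite addr0 [_ *: 1]mulr1.
Qed.

Lemma is_derive_comp_coord (R : realType) (m k : nat) (e u : 'rV[R]_m) (h : R -> R) :
  derivable h (Defs.coord u k) 1 ->
  is_derive (0 : R) 1 (fun t => h (Defs.coord (t *: e + u) k))
    (derive1 h (Defs.coord u k) * Defs.coord e k).
Proof.
move=> dh; apply: (@is_derive1_comp _ h (fun t => Defs.coord (t *: e + u) k)).
  by rewrite scale0r add0r derive1E; exact/derivableP.
exact: is_derive_coord.
Qed.

Lemma is_derive_Hfun (R : realType) (n : nat) (vstar : R) (V : R -> R)
    (s es : 'rV[R]_n.-1) (v ev : 'rV[R]_n) :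
  (forall i, (2 <= i <= n)%N -> derivable V (gap s i) 1) ->
  is_derive (0 : R) 1 (fun t => Hfun vstar V (t *: es + s) (t *: ev + v))
    (\sum_(1 <= i < n.+1) (speed v i - vstar) * speed ev i +
     \sum_(2 <= i < n.+1) derive1 V (gap s i) * gap es i).
Proof.
move=> dV; rewrite /Hfun; apply: (@is_deriveD R R R
  (fun t => 2^-1 * (\sum_(1 <= i < n.+1) (speed (t *: ev + v) i - vstar) ^+ 2))
  (fun t => \sum_(2 <= i < n.+1) V (gap (t *: es + s) i))); last first.
  apply: is_derive_bigsum => i; rewrite mem_index_iota ltnS => /dV.
  exact: is_derive_comp_coord.
have dw i : is_derive (0 : R) 1 (fun t => (speed (t *: ev + v) i - vstar) ^+ 2)
    (2 * ((speed v i - vstar) * speed ev i)).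
  have := is_derive_coord (i - 1) ev v.
  rewrite -/(speed ev i) => dsp.
  apply: (@is_derive_eq _ _ _ (((fun t => speed (t *: ev + v) i) - cst vstar) ^+ 2)).
  by rewrite /= /cst -[(_ - _) 0]/(_ - _) scale0r add0r subr0 expr1 mulrA.
have := @is_deriveZ _ _ _ _ (2^-1) _ _ _ (@is_derive_bigsum R _
  (index_iota 1 n.+1) _ _ 0 (fun i _ => dw i)).
by rewrite -mulr_sumr [_ *: (_ * _)]mulrA mulVf// mul1r.
Qed.

(** Both arguments move at once, so that [ev] = 0 and [es] = 0 give the partial derivatives in s_i
    and in v_i. The factor r H + d H * H is the derivative of x r(x) at H. *)
Lemma is_derive_Wfun (R : realType) (n : nat) (vstar : R) (V r d : R -> R)
    (s es : 'rV[R]_n.-1) (v ev : 'rV[R]_n) :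
  (forall x : R, is_derive x 1 r (d x)) ->
  (forall i, (2 <= i <= n)%N -> derivable V (gap s i) 1) ->
  (forall i, (2 <= i <= n)%N -> derivable (derive1 V) (gap s i) 1) ->
  let H := Hfun vstar V s v in
  is_derive (0 : R) 1 (fun t => Wfun vstar V r (t *: es + s) (t *: ev + v))
    ((r H + d H * H) * (\sum_(1 <= i < n.+1) (speed v i - vstar) * speed ev i +
     \sum_(2 <= i < n.+1) derive1 V (gap s i) * gap es i) -
     \sum_(2 <= i < n.+1) 4 ^+ i * (derive1n 2 V (gap s i) * gap es i * (speed v i - vstar)
        + derive1 V (gap s i) * speed ev i)).
Proof.
move=> dr dV dV' H.
pose h t := Hfun vstar V (t *: es + s) (t *: ev + v).
have h0 : h 0 = H by rewrite /h !scale0r !add0r.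
rewrite /Wfun; apply: (@is_deriveB R R R (fun t => r (h t) * h t)
  (fun t => \sum_(2 <= i < n.+1) 4 ^+ i * derive1 V (gap (t *: es + s) i)
     * (speed (t *: ev + v) i - vstar))).
  have dH := @is_derive_Hfun R n vstar V s es v ev dV.
  have drh := @is_derive1_comp R r h 0 _ _ (dr (h 0)) dH.
  have := @is_deriveM _ _ (r \o h) h _ _ _ _ drh dH.
  move=> dM; apply: is_derive_eq; rewrite /= h0 /GRing.scale /=; ring.
apply: is_derive_bigsum => i; rewrite mem_index_iota ltnS => /dV'/(is_derive_comp_coord es).
rewrite -/(gap s i) -/(gap es i) => dp.
have dw := is_derive_coord (i - 1) ev v.
apply: (@is_derive_eq _ _ _ ((4 ^+ i \*: (fun t => derive1 V (gap (t *: es + s) i)))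
  * ((fun t => speed (t *: ev + v) i) - cst vstar))).
rewrite -[((_ - _) : R -> R) 0]/(_ - _) -[(_ \*: _) 0]/(_ *: _) /=.
rewrite !scale0r !add0r /GRing.scale /= /cst.
rewrite -/(speed ev i); ring.
Qed.

Lemma big_nat_delta (R : realType) (m n i : nat) (F : nat -> R) :
  \sum_(m <= j < n) F j * (j == i)%:R = if (m <= i < n)%N then F i else 0.
Proof.
case: ifPn => mi.
  rewrite (bigD1_seq i) ?iota_uniq ?mem_index_iota//= eqxx mulr1 big1 ?addr0// => j.
  by move/negbTE->; rewrite mulr0.
rewrite big_seq_cond big1// => j /andP[]; rewrite mem_index_iota => mj _.
have /negbTE-> : j != i by apply: contraNneq mi => <-.
by rewrite mulr0.
Qed.

Lemma gap_row_delta (R : realType) (n i j : nat) : (2 <= j <= n)%N ->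
  gap (\row_(k < n.-1) (k.+2 == i)%:R : 'rV[R]_n.-1) j = (j == i)%:R.
Proof.
case: j => [|[|j]]// /andP[_ jn]; rewrite /gap !subSS subn0.
have jn' : (j < n.-1)%N by case: n jn.
by rewrite (coord_ord _ jn') mxE.
Qed.

Lemma speed_row_delta (R : realType) (n i j : nat) : (1 <= j <= n)%N ->
  speed (\row_(k < n) (k.+1 == i)%:R : 'rV[R]_n) j = (j == i)%:R.
Proof.
case: j => [|j]// /andP[_ jn]; rewrite /speed subSS subn0.
by rewrite (coord_ord _ jn) mxE.
Qed.

Lemma partial_gap_Wfun (R : realType) (n : nat) (vstar : R) (V r d : R -> R)
    (s : 'rV[R]_n.-1) (v : 'rV[R]_n) (i : nat) :
  (forall x : R, is_derive x 1 r (d x)) ->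
  (forall i, (2 <= i <= n)%N -> derivable V (gap s i) 1) ->
  (forall i, (2 <= i <= n)%N -> derivable (derive1 V) (gap s i) 1) ->
  (2 <= i <= n)%N ->
  let H := Hfun vstar V s v in
  partial_gap (Wfun vstar V r) i s v =
    (r H + d H * H) * derive1 V (gap s i)
    - 4 ^+ i * derive1n 2 V (gap s i) * (speed v i - vstar).
Proof.
move=> dr dV dV' hi H; apply: derive_along_line.
have := @is_derive_Wfun R n vstar V r d s
   (\row_(j < n.-1) (j.+2 == i)%:R) v 0 dr dV dV'.
under eq_fun do rewrite scaler0 add0r.
move=> dW; apply: is_derive_eq; rewrite -/H.
rewrite [X in _ * (X + _)]big1 => [|j _]; last by rewrite /speed coord0 mulr0.
rewrite add0r (_ : \sum_(2 <= j < n.+1) derive1 V (gap s j) * _ = derive1 V (gap s i)).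
  congr (_ - _).
  transitivity (\sum_(2 <= j < n.+1)
      (4 ^+ j * derive1n 2 V (gap s j) * (speed v j - vstar)) * (j == i)%:R).
    apply: eq_big_nat => j; rewrite ltnS => hj.
    by rewrite gap_row_delta// /speed coord0; ring.
  by rewrite big_nat_delta ltnS hi.
transitivity (\sum_(2 <= j < n.+1) derive1 V (gap s j) * (j == i)%:R).
  by apply: eq_big_nat => j; rewrite ltnS => hj; rewrite gap_row_delta.
by rewrite big_nat_delta ltnS hi.
Qed.

(** The speed v_1 is absent from the cross term, which starts at i = 2; hence the conditional. *)
Lemma partial_speed_Wfun (R : realType) (n : nat) (vstar : R) (V r d : R -> R)
    (s : 'rV[R]_n.-1) (v : 'rV[R]_n) (i : nat) :
  (forall x : R, is_derive x 1 r (d x)) ->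
  (forall i, (2 <= i <= n)%N -> derivable V (gap s i) 1) ->
  (forall i, (2 <= i <= n)%N -> derivable (derive1 V) (gap s i) 1) ->
  (1 <= i <= n)%N ->
  let H := Hfun vstar V s v in
  partial_speed (Wfun vstar V r) i s v =
    (r H + d H * H) * (speed v i - vstar)
    - 4 ^+ i * (if (2 <= i <= n)%N then derive1 V (gap s i) else 0).
Proof.
move=> dr dV dV' hi H; apply: derive_along_line.
have := @is_derive_Wfun R n vstar V r d s 0 v
   (\row_(j < n) (j.+1 == i)%:R) dr dV dV'.
under eq_fun do rewrite scaler0 add0r.
move=> dW; apply: is_derive_eq; rewrite -/H.
rewrite [X in _ * (_ + X)]big1 => [|j _]; last by rewrite /gap coord0 mulr0.
rewrite addr0 (_ : \sum_(1 <= j < n.+1) _ * speed _ j = speed v i - vstar).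
  congr (_ - _).
  transitivity (\sum_(2 <= j < n.+1) (4 ^+ j * derive1 V (gap s j)) * (j == i)%:R).
    apply: eq_big_nat => j /andP[j2]; rewrite ltnS => hj.
    by rewrite speed_row_delta ?(ltnW j2)// /gap coord0; ring.
  by rewrite big_nat_delta ltnS; case: ifP; rewrite ?mulr0.
transitivity (\sum_(1 <= j < n.+1) (speed v j - vstar) * (j == i)%:R).
  by apply: eq_big_nat => j; rewrite ltnS => hj; rewrite speed_row_delta.
by rewrite big_nat_delta ltnS hi.
Qed.

(** * Decay of the whole sum and size of the cross term *)

(** Sums [lyapunov_term] with M = 4^n Q; the boundary terms G_1 and G_{n+1} vanish because P and q
    vanish at 1 and n + 1. *)
Lemma lyapunov_decay (R : realType) (n : nat) (mu bmu A K Q : R) (w P q k : nat -> R) :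
  0 < mu -> 0 <= A -> 0 <= K -> P 1%N = 0 -> P n.+1 = 0 -> q 1%N = 0 -> q n.+1 = 0 ->
  (forall i, 0 <= q i <= Q) -> (forall i, (1 <= i <= n)%N -> mu <= k i <= K) ->
  bmu / mu + 4 ^+ n * K + 2 * (4 ^+ n * Q) / mu <= A ->
  0 <= bmu ->
  \sum_(1 <= i < n.+1) ((A * P i - 4 ^+ i * q i * w i) * (w (i - 1)%N - w i) +
     (A * w i - 4 ^+ i * P i) * (- k i * w i + P i - P i.+1))
  <= \sum_(1 <= i < n.+1) (- (bmu * w i ^+ 2) - 8^-1 * (4 ^+ i * P i ^+ 2)).
Proof.
move=> mu0 A0 K0 P1 Pn q1 qn hq hk hA bmu0.
have Q0 : 0 <= Q by have /andP[q0 qQ] := hq 0%N; exact: le_trans qQ.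
have pow i : (i <= n)%N -> (4 : R) ^+ i <= 4 ^+ n.
  by move=> ?; rewrite ler_weXn2l// ler1n.
have pow0 i : 0 <= (4 : R) ^+ i by rewrite exprn_ge0.
have hqM i : (1 <= i <= n.+1)%N -> 4 ^+ i * q i <= 4 ^+ n * Q.
  (* At i = n + 1 the weight exceeds 4^n, but q_{n+1} = 0. *)
  move=> /andP[_]; rewrite leq_eqVlt => /predU1P[->|].
    by rewrite qn mulr0 mulr_ge0.
  rewrite ltnS => /pow hi; have /andP[q0 qQ] := hq i.
  exact: ler_pM.
apply: (@telescoping_sum_le _ _ _ _ _ (fun i => A * P i * w (i - 1)%N
   - 4 ^+ i / 8 * P i ^+ 2 + 4 ^+ i / 2 * q i * w (i - 1)%N ^+ 2)) => //.
- by rewrite P1 q1; ring.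
- by rewrite Pn qn; ring.
move=> i; rewrite ltnS => hi; have /andP[i1 iN] := hi.
have /andP[muk kK] := hk i hi.
have := @lyapunov_term R (4 ^+ i) A (k i) (4 ^+ n * Q) mu bmu (w (i - 1)%N) (w i)
  (P i) (P i.+1) (q i) (q i.+1).
rewrite subSS subn0 [4 ^+ i.+1]exprS; apply => //.
- by have /andP[] := hq i.
- by apply: hqM; rewrite i1 (leq_trans iN).
- by rewrite -exprS hqM// ltnS.
have k0 : 0 <= k i by apply: le_trans muk; exact: ltW.
(* The lower bound on A is free of k_i. Multiplied by k_i, its terms divided by mu regain their size
   since k_i / mu >= 1, and K >= k_i yields 4^i k_i^2. *)
apply: (le_trans _ (ler_wpM2r k0 hA)).
have le1 : 1 <= k i / mu by rewrite ler_pdivlMr// mul1r.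
have y1 := ler_wpM2l bmu0 le1; rewrite mulr1 in y1.
have y2 : 2 * (4 ^+ n * Q) <= 2 * (4 ^+ n * Q) * (k i / mu).
  by rewrite -[leLHS]mulr1 ler_wpM2l// !mulr_ge0.
have y3 : 4 ^+ i * k i ^+ 2 <= 4 ^+ n * K * k i.
  by rewrite expr2 mulrA ler_wpM2r// ler_pM// pow.
rewrite [leRHS](_ : _ = bmu * (k i / mu) + 4 ^+ n * K * k i + 2 * (4 ^+ n * Q) * (k i / mu)).
  by rewrite !lerD.
ring.
Qed.

(* With the conventions V'(s_1) = V'(s_{n+1}) = 0 the three cases of the model become one. *)
Lemma accel_uniform (R : realType) (n : nat) (mu vmax vstar : R) (V f : R -> R)
    (i : nat) (s : 'rV[R]_n.-1) (v : 'rV[R]_n) :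
  (2 <= n)%N -> (1 <= i <= n)%N ->
  let P j := if (2 <= j <= n)%N then derive1 V (gap s j) else 0 in
  accel mu vmax vstar V f i s v =
    - (mu + gfun vmax vstar f (P i - P i.+1)) * (speed v i - vstar) + P i - P i.+1.
Proof.
move=> n2 /andP[i1 iN] P; rewrite /accel /kgain.
case: (eqVneq i 1%N) => [->|i1'].
  by rewrite /P /= n2 sub0r addr0.
have i2 : (2 <= i)%N by case: i i1 i1' {iN} => [|[|i]].
case: (eqVneq i n) => [->|iNn]; first by rewrite /P n2 leqnn ltnn andbF !subr0.
have iN' : (i < n)%N by rewrite ltn_neqAle iNn.
by rewrite /P i2 iN iN' (leq_trans i2 _).
Qed.

(** Young's inequality: |p w| <= p^2/2 + w^2/2 <= Q u + w^2/2 <= (Q + 1)(w^2/2 + u). *)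
Lemma cross_term_le (R : realType) (n : nat) (Q : R) (p u w : nat -> R) :
  0 <= Q -> (forall i, (2 <= i <= n)%N -> 0 <= u i) ->
  (forall i, (2 <= i <= n)%N -> p i ^+ 2 <= 2 * Q * u i) ->
  `| \sum_(2 <= i < n.+1) 4 ^+ i * p i * w i | <=
   4 ^+ n * (Q + 1) * (2^-1 * (\sum_(1 <= i < n.+1) w i ^+ 2) + \sum_(2 <= i < n.+1) u i).
Proof.
move=> Q0 u0 pu.
apply: (le_trans (ler_norm_sum _ _ _)).
apply: (@le_trans _ _ (\sum_(2 <= i < n.+1) 4 ^+ n * (Q + 1) * (2^-1 * w i ^+ 2 + u i))).
  rewrite big_seq_cond [leRHS]big_seq_cond; apply: ler_sum => i.
  rewrite mem_index_iota andbT ltnS => hi; have /andP[_ iN] := hi.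
  rewrite -!mulrA normrM ger0_norm ?exprn_ge0// ler_pM ?exprn_ge0//.
    by rewrite ler_weXn2l// ler1n.
  have := pu i hi; have := u0 i hi; have := sqr_ge0 (w i).
  have w2 := sqr_ge0 (w i); have := mulr_ge0 Q0 w2.
  have := sqr_ge0 (p i - w i); have := sqr_ge0 (p i + w i).
  rewrite ler_norml => *; apply/andP; split; nra.
rewrite -mulr_sumr ler_wpM2l ?mulr_ge0 ?exprn_ge0 ?addr_ge0//.
rewrite big_split/= -mulr_sumr lerD2r ler_wpM2l//.
have [n0|n0] := leqP n 0.
  move: n0; rewrite leqn0 => /eqP ->.
  by rewrite !big_geq.
by rewrite [leRHS]big_ltn ?ltnS// lerDr sqr_ge0.
Qed.

(** * Choice of R and kappa, and verification of the inequalities *)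

Unset Implicit Arguments.
Set Strict Implicit.
Set Printing Implicit Defensive.

Theorem theorem2p2 (R : realType) (n : nat) (mu lam L vmax vstar : R)
    (V f : R -> R)
    (hn : (2 <= n)%N) (hmu : 0 < mu) (hL : 0 < L) (hlam : L < lam)
    (hvstar : 0 < vstar) (hvmax : vstar < vmax)
    (hVC2 : C2_right_of L V)
    (hVge0 : forall s : R, L < s -> 0 <= V s)
    (hVlim : V s @[s --> L^'+] --> +oo)
    (hVconvex : forall s : R, L < s -> 0 <= derive1n 2 V s)
    (hVzero : forall s : R, lam <= s -> V s = 0)
    (hVdecr : forall s : R, L < s -> s < lam -> derive1 V s < 0)
    (hfC1 : C1_real f)
    (hfmono : forall x y : R, x <= y -> f x <= f y)
    (hfge : forall x : R, Num.max x 0 <= f x) :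
  forall beta : R, 0 < beta ->
  exists r kappa : R -> R,
    [/\ C1_nonneg r, nondecreasing_nonneg r & positive_nonneg r] /\
    [/\ C0_nonneg kappa, nondecreasing_nonneg kappa & positive_nonneg kappa] /\
    forall (s : 'rV[R]_n.-1) (v : 'rV[R]_n), Omega L vmax s v ->
      let H := Hfun vstar V in
      let W := Wfun vstar V r in
      H s v <= W s v <= kappa (H s v) * H s v /\
      time_derivative mu vmax vstar V f W s v <=
        - (beta * mu * \sum_(1 <= i < n.+1) (speed v i - vstar) ^+ 2)
        - 8^-1 * \sum_(2 <= i < n.+1) 4 ^+ i * derive1 V (gap s i) ^+ 2.
Proof.
move=> beta beta0.
(* One pair of bounds per m, for V'' and for -V' on {V <= m + 1}; it serves all states with [truncn]
   H = m. *)
have /choice[QB hQB] : forall m : nat, exists qb : R * R, [/\ 0 <= qb.1, 0 <= qb.2 &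
    forall x, L < x -> V x <= m.+1%:R ->
    [/\ derive1n 2 V x <= qb.1, - qb.2 <= derive1 V x
      & derive1 V x ^+ 2 <= 2 * qb.1 * V x]].
  move=> m.
  have [Q [B hb]] := potential_sublevel_bounds m.+1%:R hVC2 hlam hVlim hVconvex hVzero.
  by exists (Q, B).
pose K m := mu + (gfun vmax vstar f (QB m).2 + 2 * (QB m).2 / vstar).
(* The first summand is what the decay asks of A, the second the cross-term constant plus 1, which
   yields W >= H. Both are nonnegative, so their sum dominates each. *)
pose Phi m := (beta * mu / mu + 4 ^+ n * K m + 2 * (4 ^+ n * (QB m).1) / mu)
  + (4 ^+ n * ((QB m).1 + 1) + 1).
have K0 m : 0 <= K m.
  have [_ B0 _] := hQB m.
  apply: addr_ge0; [exact: ltW|apply: addr_ge0; [exact: gfun_ge0|]].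
  by rewrite divr_ge0 ?mulr_ge0 ?(ltW hvstar).
have c0 m : 0 <= beta * mu / mu + 4 ^+ n * K m + 2 * (4 ^+ n * (QB m).1) / mu.
  have [Q0 _ _] := hQB m.
  by rewrite !addr_ge0 ?divr_ge0 ?mulr_ge0 ?exprn_ge0 ?(ltW hmu) ?(ltW beta0).
have c1 m : 0 <= 4 ^+ n * ((QB m).1 + 1).
  have [Q0 _ _] := hQB m.
  by rewrite mulr_ge0 ?exprn_ge0// addr_ge0.
have [r [d [dr cd r_homo d0 rPhi]]] := exists_C1_majorant Phi.
have cr : continuous r.
  by move=> x; apply/differentiable_continuous/derivable1_diffP; case: (dr x).
have r1 x : 0 <= x -> 1 <= r x.
  move=> x0; apply: le_trans (rPhi x x0); rewrite /Phi.
  by rewrite -[leLHS]add0r addrA lerD2r addr_ge0.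
have rgt0 x : 0 <= x -> 0 < r x by move=> /r1; exact: lt_le_trans.
(* The cross term is at most C H with C + 1 <= r(H), so W <= (r(H) + C) H <= 2 r(H) H. *)
exists r, (fun x => 2 * r x); split; [split|split; [split|]].
- split; first exact: continuous_subspaceT.
  exists d; first exact: continuous_subspaceT.
  by move=> x _; exact: dr.
- by move=> x y _; exact: r_homo.
- exact: rgt0.
- apply: continuous_subspaceT => x.
  by apply: cvgM; [exact: cvg_cst|exact: cr].
- by move=> x y _ xy; rewrite ler_pM2l// r_homo.
- by move=> x x0; rewrite mulr_gt0// rgt0.
move=> s v [hs _] H W.
set h := H s v.
have V0 i : (2 <= i <= n)%N -> 0 <= V (gap s i) by move=> /hs; exact: hVge0.
have sV0 : 0 <= \sum_(2 <= i < n.+1) V (gap s i).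
  by rewrite big_nat_cond; apply: sumr_ge0 => i; rewrite andbT ltnS; exact: V0.
have sw0 : 0 <= 2^-1 * \sum_(1 <= i < n.+1) (speed v i - vstar) ^+ 2.
  by rewrite mulr_ge0// sumr_ge0// => i _; exact: sqr_ge0.
have h0 : 0 <= h by exact: addr_ge0.
pose m := Num.truncn h.
(* All summands of H are nonnegative, so each V(s_i) is at most H < m + 1. *)
have Vh i : (2 <= i <= n)%N -> V (gap s i) <= m.+1%:R.
  move=> hi; apply: (le_trans _ (ltW (truncnS_gt h))).
  apply: (@le_trans _ _ (\sum_(2 <= i < n.+1) V (gap s i))); last by rewrite lerDr.
  rewrite (bigD1_seq i) ?iota_uniq ?mem_index_iota//= lerDl.
  rewrite big_seq_cond; apply: sumr_ge0 => j.
  by rewrite mem_index_iota ltnS => /andP[hj _]; exact: V0.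
have [Q0 B0 hb] := hQB m.
have bnd i (hi : (2 <= i <= n)%N) := hb _ (hs i hi) (Vh i hi).
have rh := rPhi h h0; rewrite -/m in rh.
split.
  have cross : `| \sum_(2 <= i < n.+1) 4 ^+ i * derive1 V (gap s i) * (speed v i - vstar) |
      <= 4 ^+ n * ((QB m).1 + 1) * h.
    apply: (@cross_term_le R n (QB m).1 (fun i => derive1 V (gap s i))
      (fun i => V (gap s i)) (fun i => speed v i - vstar)) => // i hi.
    by have [] := bnd i hi.
  have rh' : 4 ^+ n * ((QB m).1 + 1) + 1 <= r h.
    by apply: le_trans rh; rewrite /Phi lerDr.
  have := ler_wpM2r h0 rh'.
  move: cross; rewrite ler_norml /W /Wfun -/(H s v) -/h => /andP[? ?] ?.
  apply/andP; split; lra.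
set w := fun i => speed v i - vstar.
pose P i : R := if (2 <= i <= n)%N then derive1 V (gap s i) else 0.
pose q i : R := if (2 <= i <= n)%N then derive1n 2 V (gap s i) else 0.
set A := r h + d h * h.
have dV i : (2 <= i <= n)%N -> derivable V (gap s i) 1.
  by move=> /hs; exact: C2_derivable.
have dV' i : (2 <= i <= n)%N -> derivable (derive1 V) (gap s i) 1.
  by move=> /hs; exact: C2_derivable_derive1.
have PB i : - (QB m).2 <= P i <= 0.
  rewrite /P; case: ifPn => hi; last by rewrite oppr_le0 B0 lexx.
  have [_ -> _] := bnd i hi.
  exact: (potential_derive1_le0 hVC2 hVconvex hVzero (hs i hi)).
pose k i := mu + gfun vmax vstar f (P i - P i.+1).
have -> : time_derivative mu vmax vstar V f W s v =
  \sum_(1 <= i < n.+1) ((A * P i - 4 ^+ i * q i * w i) * (w (i - 1)%N - w i) +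
     (A * w i - 4 ^+ i * P i) * (- k i * w i + P i - P i.+1)).
  rewrite /time_derivative big_split/=; congr (_ + _).
    (* The added term i = 1 contains [w 0], a value without meaning in the model; its coefficient is
       0 because P_1 = q_1 = 0. *)
    rewrite [RHS]big_ltn ?ltnS ?(ltnW hn)// {1}/P {1}/q /= !mulr0 mul0r subr0 mul0r add0r.
    apply: eq_big_nat => i; rewrite ltnS => hi.
    rewrite /W (partial_gap_Wfun vstar v dr dV dV' hi) -/(H s v) -/h -/A /P /q hi /w.
    ring.
  apply: eq_big_nat => i; rewrite ltnS => hi.
  by rewrite /W (partial_speed_Wfun vstar v dr dV dV' hi) (accel_uniform _ _ _ _ _ _ _ hn hi).
have -> : - (beta * mu * \sum_(1 <= i < n.+1) (speed v i - vstar) ^+ 2)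
    - 8^-1 * (\sum_(2 <= i < n.+1) 4 ^+ i * derive1 V (gap s i) ^+ 2) =
  \sum_(1 <= i < n.+1) (- (beta * mu * w i ^+ 2) - 8^-1 * (4 ^+ i * P i ^+ 2)).
  rewrite big_split/= sumrN -mulr_sumr sumrN -mulr_sumr; congr (_ - _ * _).
  rewrite [RHS]big_ltn ?ltnS ?(ltnW hn)// {1}/P /= expr0n mulr0 add0r.
  by apply: eq_big_nat => i; rewrite ltnS /P => ->.
apply: (@lyapunov_decay R n mu (beta * mu) A (K m) (QB m).1) => //.
- by rewrite addr_ge0 ?mulr_ge0// ltW// rgt0.
- by rewrite /P ltnn andbF.
- by rewrite /q ltnn andbF.
- move=> i; rewrite /q; case: ifPn => hi; last by rewrite lexx Q0.
  by rewrite (hVconvex _ (hs i hi)); have [] := bnd i hi.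
- move=> i hi; rewrite /k lerDl gfun_ge0//= /K lerD2l.
  (* P_i and P_{i+1} both lie in [-B, 0], so their difference lies in [-B, B]. *)
  apply: gfun_le => //; have := PB i; have := PB i.+1.
  by move=> /andP[? ?] /andP[? ?]; apply/andP; split; lra.
(* A >= r(H) because d and H are nonnegative; this is where the monotonicity of R enters the
   decay. *)
- apply: (@le_trans _ _ (r h)); last by rewrite lerDl mulr_ge0.
  by apply: le_trans rh; rewrite /Phi lerDl addr_ge0.
- by rewrite mulr_ge0// ltW.
Qed.
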